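(* For every positive integer $n \geq 9$, \[ A_n=\{k \in \mathbb{N} \mid k \geq n\}, \] where $A_n=\left\{ s \in \mathbb{N} \;\middle|\; \exists\, a_1, \dots, a_n \in \mathbb{Q}_{>0} \text{ with } \prod_{i=1}^{n}a_i=1 \text{ and } \sum_{i=1}^{n}a_i=s \right\}$. Equivalently, for all integers $m \geq n \geq 9$ there exist $n$ positive rational numbers whose product is $1$ and whose sum is $m$, and no positive integer $s<n$ is the sum of $n$ positive rationals with product $1$.
   Context: $\mathbb{N}$ denotes the set of positive integers and $\mathbb{Q}_{>0}$ the set of positive rational numbers. For $n \in \mathbb{N}$, $A_n$ is the set of positive integers $s$ that can be written as $s=a_1+\dots+a_n$ with $a_1,\dots,a_n$ positive rationals satisfying $a_1 a_2\cdots a_n=1$. *)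

(* Defs.v *)
From mathcomp Require Import all_boot all_order all_algebra.
Set Implicit Arguments. Unset Strict Implicit. Unset Printing Implicit Defensive.
Import Order.TTheory GRing.Theory Num.Theory.
Local Open Scope ring_scope.

Definition in_A (n : nat) (s : nat) : Prop :=
  (0 < s)%N /\
  exists a : 'I_n -> rat,
    (forall i, 0 < a i) /\
    \prod_(i < n) a i = 1 /\
    \sum_(i < n) a i = s%:R.

(* Main.v *)
Require Import Defs.
From mathcomp Require Import all_boot all_order all_algebra.
From mathcomp Require Import zify ring lra.

(** For [A = k^2 - k + 1] and [B = k^2 + k + 1] the three positive rationals
    [l A^2 / (2 B)], [l B^2 / (2 A)], [4 l / (A B)] have product [l^3] and sum
    [l (k^2 + 5)]. Three such triples with [(l, k) = (4, x/8), (4, y/8), (1/16, z)]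
    have product [1] and sum [m] as soon as [x^2 + y^2 + z^2 = 16 m - 645]. Since
    [16 m - 645 = 3 mod 8], Gauss's theorem on three triangular numbers provides
    such odd [x, y, z] when [m >= 41]; smaller [m] are handled by explicit lists, and
    [n > 9] by padding with ones. The converse inequality is AM-GM.

    Gauss's theorem is proved by computing the cube of the series [psi] whose
    exponents are the triangular numbers. The coefficients of [psi^4] are sums of
    divisors [sigma (2N+1)]: both satisfy the recurrence expressing the logarithmic
    derivative of [psi^4], the one for [sigma] by the involution on solutions of
    [x^2 + 4yz = M] familiar from the two-squares theorem. The number of reduced
    binary quadratic forms [a X^2 + J XY + b Y^2] with [4ab - J^2 = 8N+3] and
    [a, b, J] odd, multiplied by [psi], also yields [sigma (2N+1)] (a class number
    relation, obtained by elementary bijections between solutions of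
    [p s + q r = n]). Hence it is the coefficient of [psi^3], and it is positive. *)

Set Implicit Arguments. Unset Strict Implicit. Unset Printing Implicit Defensive.
Import Order.TTheory GRing.Theory Num.Theory.
Local Open Scope ring_scope.

(** * Counting with finite lists *)

Lemma perm_map_filter (T1 T2 : eqType) (s1 : seq T1) (s2 : seq T2)
    (P1 : pred T1) (P2 : pred T2) (f : T1 -> T2) (g : T2 -> T1) :
    uniq s1 -> uniq s2 ->
    (forall x, x \in s1 -> P1 x -> [/\ f x \in s2, P2 (f x) & g (f x) = x]) ->
    (forall y, y \in s2 -> P2 y -> [/\ g y \in s1, P1 (g y) & f (g y) = y]) ->
  perm_eq [seq f x | x <- s1 & P1 x] [seq y <- s2 | P2 y].
Proof.
move=> u1 u2 fP gP; apply: uniq_perm; last 1 first.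
- move=> y; rewrite mem_filter; apply/mapP/andP => [[x]|[Py sy]].
    by rewrite mem_filter => /andP[Px sx] ->; have [] := fP x sx Px.
  by have [sg Pg <-] := gP y sy Py; exists (g y); rewrite // mem_filter Pg.
- rewrite map_inj_in_uniq ?filter_uniq // => x x'.
  rewrite !mem_filter => /andP[Px sx] /andP[Px' sx'] eqf.
  by have [_ _ <-] := fP x sx Px; have [_ _ <-] := fP x' sx' Px'; rewrite eqf.
- exact: filter_uniq.
Qed.

Lemma count_bij (T1 T2 : eqType) (s1 : seq T1) (s2 : seq T2)
    (P1 : pred T1) (P2 : pred T2) (f : T1 -> T2) (g : T2 -> T1) :
    uniq s1 -> uniq s2 ->
    (forall x, x \in s1 -> P1 x -> [/\ f x \in s2, P2 (f x) & g (f x) = x]) ->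
    (forall y, y \in s2 -> P2 y -> [/\ g y \in s1, P1 (g y) & f (g y) = y]) ->
  count P1 s1 = count P2 s2.
Proof.
move=> u1 u2 fP gP; have /perm_size := perm_map_filter u1 u2 fP gP.
by rewrite size_map !size_filter.
Qed.

Lemma sum_bij (T1 T2 : eqType) (R : nmodType) (s1 : seq T1) (s2 : seq T2)
    (P1 : pred T1) (P2 : pred T2) (f : T1 -> T2) (g : T2 -> T1) (F : T2 -> R) :
    uniq s1 -> uniq s2 ->
    (forall x, x \in s1 -> P1 x -> [/\ f x \in s2, P2 (f x) & g (f x) = x]) ->
    (forall y, y \in s2 -> P2 y -> [/\ g y \in s1, P1 (g y) & f (g y) = y]) ->
  \sum_(x <- s1 | P1 x) F (f x) = \sum_(y <- s2 | P2 y) F y.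
Proof.
move=> u1 u2 fP gP; have e := perm_map_filter u1 u2 fP gP.
by rewrite -[RHS]big_filter -(perm_big _ e) big_map big_filter.
Qed.

Lemma sum_fibers (T : eqType) (R : nmodType) (l : seq T) (P : pred T)
    (K : nat) (h : T -> nat) (F : T -> R) :
    {in l, forall w, P w -> (h w < K)%N} ->
  \sum_(w <- l | P w) F w =
  \sum_(j < K) \sum_(w <- l | P w && (h w == j)) F w.
Proof.
move=> hK; rewrite (exchange_big_dep P) /=; last by move=> ? ? _ /andP[].
rewrite big_seq_cond [RHS]big_seq_cond; apply: eq_bigr => w /andP[wl Pw].
rewrite (big_pred1 (Ordinal (hK w wl Pw))) // => j.
by rewrite Pw eq_sym.
Qed.

(** The numeric hypothesis says that [Qs] partitions [P] pointwise on [l]; every later case split is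
    verified through such an identity. *)
Lemma count_sum (T : eqType) (l : seq T) (P : T -> bool) (Qs : seq (T -> bool)) :
    {in l, forall x, P x = sumn [seq nat_of_bool (Q x) | Q <- Qs] :> nat} ->
  count P l = sumn [seq count (Q : T -> bool) l | Q <- Qs].
Proof.
move=> PQ; rewrite -sum1_count big_mkcond sumnE big_map.
transitivity (\sum_(x <- l) \sum_(Q <- Qs) nat_of_bool (Q x))%N.
  by apply: eq_big_seq => x xl; have := PQ x xl; rewrite sumnE big_map => <-.
rewrite exchange_big; apply: eq_bigr => Q _.
by rewrite -sum1_count [RHS]big_mkcond; apply: eq_bigr => x _; case: (Q x).
Qed.

Lemma size_count_sum (T : eqType) (l : seq T) (Qs : seq (T -> bool)) :
    {in l, forall x, sumn [seq nat_of_bool (Q x) | Q <- Qs] = 1%N} ->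
  size l = sumn [seq count (Q : T -> bool) l | Q <- Qs].
Proof.
move=> Q1; rewrite -[LHS](count_predT l).
by apply: count_sum => x xl; rewrite Q1.
Qed.

Arguments count_sum {T l P} Qs.
Arguments size_count_sum {T l} Qs.

Definition ints (a : int) (k : nat) : seq int := [seq a + i%:Z | i <- iota 0 k].

Lemma mem_ints a k x : (x \in ints a k) = (a <= x < a + k%:Z).
Proof.
apply/mapP/idP => [[i]|xP]; first by rewrite mem_iota => ? ->; lia.
by exists `|x - a|%N; rewrite ?mem_iota; lia.
Qed.

Lemma uniq_ints a k : uniq (ints a k).
Proof. by rewrite map_inj_uniq ?iota_uniq // => i j; lia. Qed.

Definition pairs (T1 T2 : Type) (s : seq T1) (t : seq T2) : seq (T1 * T2) :=
  [seq (x, y) | x <- s, y <- t].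

Lemma mem_pairs (T1 T2 : eqType) (s : seq T1) (t : seq T2) x y :
  ((x, y) \in pairs s t) = (x \in s) && (y \in t).
Proof.
by apply/allpairsP/andP => [[[a b] /= [sa tb [-> ->]]]|[sx ty]] //; exists (x, y).
Qed.

Lemma uniq_pairs (T1 T2 : eqType) (s : seq T1) (t : seq T2) :
  uniq s -> uniq t -> uniq (pairs s t).
Proof. by move=> us ut; apply: allpairs_uniq => // -[a b] [c d] _ _ /= [-> ->]. Qed.

(** * Solutions of [p s + q r = n] *)

Notation quad := (int * int * int * int)%type.

(** Positive entries with [p t + q r = n] are all at most [n], so the box loses no solution. *)
Definition quads (n : nat) : seq quad :=
  let s := ints 1 n in
  [seq w <- pairs (pairs (pairs s s) s) s |
     let: (p, q, r, t) := w in p * t + q * r == n%:Z].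

Lemma uniq_quads n : uniq (quads n).
Proof. by rewrite filter_uniq // !uniq_pairs // uniq_ints. Qed.

Lemma mem_quads n p q r s :
  ((p, q, r, s) \in quads n) =
  [&& 0 < p, 0 < q, 0 < r, 0 < s & p * s + q * r == n%:Z].
Proof.
rewrite mem_filter !mem_pairs !mem_ints.
by apply/idP/idP; nia.
Qed.

Notation qpred := (int -> int -> int -> int -> bool).

Definition qapp (P : qpred) (w : quad) : bool :=
  let: (p, q, r, s) := w in P p q r s.

Definition nquads (n : nat) (P : qpred) : nat := count (qapp P) (quads n).

Lemma nquads_sum (n : nat) (P : qpred) (Qs : seq qpred) :
    (forall p q r s : int, 0 < p -> 0 < q -> 0 < r -> 0 < s ->
       P p q r s = sumn [seq nat_of_bool (Q p q r s) | Q <- Qs] :> nat) ->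
  nquads n P = sumn [seq nquads n Q | Q <- Qs].
Proof.
move=> PQ; rewrite /nquads (count_sum [seq qapp Q | Q <- Qs]) -?map_comp //.
move=> [[[p q] r] s]; rewrite mem_quads => /and5P[p0 q0 r0 s0 _].
by rewrite -map_comp /= PQ.
Qed.

Arguments nquads_sum {n P} Qs.

Lemma nquads_bij (n : nat) (P Q : qpred) (f g : quad -> quad) :
    (forall w, w \in quads n -> qapp P w ->
       [/\ f w \in quads n, qapp Q (f w) & g (f w) = w]) ->
    (forall w, w \in quads n -> qapp Q w ->
       [/\ g w \in quads n, qapp P (g w) & f (g w) = w]) ->
  nquads n P = nquads n Q.
Proof. by move=> fP gP; apply: count_bij fP gP; apply: uniq_quads. Qed.

Notation odz x := ((x %% 2)%Z == 1).

Ltac quad_bij F G :=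
  apply: (nquads_bij (f := fun w => let: (p, q, r, s) := w in F p q r s)
                     (g := fun w => let: (p, q, r, s) := w in G p q r s));
  move=> [[[p q] r] s]; rewrite /= !mem_quads => valid cond;
  split; rewrite ?mem_quads; try (by lia); do ?congr (_, _); lia.

(** The shift [(p, q, r, s) -> (p, q, r + p, s - q)] maps [clsC] to [clsA], and
    [clsA] consists of [clsO] and its image under the exchange of [p] and [s]. *)
Definition clsA (p q r s : int) := [&& odz (p + s), odz q & odz r].
Definition clsC (p q r s : int) := [&& odz q, odz (p + r) & odz (s + r)].
Definition clsO (p q r s : int) := [&& odz p, odz q, odz r & ~~ odz s].

Lemma nquads_swap_ps n (P : qpred) :
  nquads n P = nquads n (fun p q r s => P s q r p).
Proof.
quad_bij (fun p q r s : int => (s, q, r, p)) (fun p q r s : int => (s, q, r, p)).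
Qed.

Lemma nquads_swap_qr n (P : qpred) :
  nquads n P = nquads n (fun p q r s => P p r q s).
Proof.
quad_bij (fun p q r s : int => (p, r, q, s)) (fun p q r s : int => (p, r, q, s)).
Qed.

(** Under the shift [p + q < s] turns into [p < s], and positivity of the old [r] into [p < r]. *)
Lemma nquads_C_large n :
  nquads n (fun p q r s => clsC p q r s && (p + q < s)) =
  nquads n (fun p q r s => [&& clsA p q r s, p < s & p < r]).
Proof.
rewrite /clsA /clsC.
quad_bij (fun p q r s : int => (p, q, r + p, s - q))
         (fun p q r s : int => (p, q, r - p, s + q)).
Qed.

(** In [clsC] the sum [p + q + s] is odd, so no triangle inequality is an equality. At most one can
    fail; failures of the last two imply [q < p + s] and are exchanged by swapping [p] and [s]. *)
Lemma nquads_C_triangle n :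
  nquads n (fun p q r s => clsC p q r s && (q < p + s)) =
  (nquads n (fun p q r s =>
               [&& clsC p q r s, q < p + s, p < q + s & s < p + q]%R) +
   2 * nquads n (fun p q r s => [&& clsA p q r s, p < s & p < r]%R))%N.
Proof.
have /= <- := nquads_C_large n.
have /= swap := nquads_swap_ps n (fun p q r s => clsC p q r s && (p + q < s)).
rewrite mul2n -addnn [in X in (_ + (_ + X))%N]swap.
rewrite (nquads_sum [::
  fun p q r s => [&& clsC p q r s, q < p + s, p < q + s & s < p + q];
  fun p q r s => clsC p q r s && (p + q < s);
  fun p q r s => clsC s q r p && (s + q < p)]) /= ?addn0 ?addnA //.
move=> p q r s p0 q0 r0 s0 /=; have -> : clsC s q r p = clsC p q r s.
  by rewrite /clsC [odz (s + r) && _]andbC.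
case: (boolP (clsC p q r s)) => //= /and3P[qo pr sr].
rewrite [q + s]addrC.
by case: (ltgtP q (p + s)); case: (ltgtP p (s + q)); case: (ltgtP s (p + q)) => //=; lia.
Qed.

(** A solution encodes a form with coefficients [q], [r] and [s - p]; the bijection
    moves to a neighbouring form and keeps [p + s]. *)
Lemma nquads_A_child n :
  nquads n (fun p q r s => [&& clsA p q r s, 2 * r < s - p & s - p < q + r]) =
  nquads n (fun p q r s => [&& clsA p q r s, p < s & r < p]).
Proof.
symmetry; rewrite /clsA.
quad_bij (fun p q r s : int => (p - r, q + (s - p) + r, r, s + r))
         (fun p q r s : int => (p + r, q - (s - p) + r, r, s - r)).
Qed.

(** In [clsA] the difference [s - p] is odd, so it differs from [2 q], [2 r] and [q + r]. Below
    [q + r] it can exceed at most one of [2 q], [2 r]; these two cases are swapped by exchanging [q]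
    and [r]. *)
Lemma nquads_A_root n :
  nquads n (fun p q r s => clsA p q r s && (p < s)) =
  (nquads n (fun p q r s =>
               [&& clsA p q r s, p < s, s - p < 2 * q & s - p < 2 * r]%R) +
   2 * nquads n (fun p q r s => [&& clsA p q r s, p < s & r < p]%R) +
   nquads n (fun p q r s => clsA p q r s && (q + r < s - p)%R))%N.
Proof.
have /= <- := nquads_A_child n.
have /= swap := nquads_swap_qr n
  (fun p q r s => [&& clsA p q r s, 2 * r < s - p & s - p < q + r]).
rewrite mul2n -addnn [in X in (_ + (_ + X) + _)%N]swap.
rewrite (nquads_sum [::
  fun p q r s => [&& clsA p q r s, p < s, s - p < 2 * q & s - p < 2 * r];
  fun p q r s => [&& clsA p q r s, 2 * r < s - p & s - p < q + r];
  fun p q r s => [&& clsA p r q s, 2 * q < s - p & s - p < r + q];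
  fun p q r s => clsA p q r s && (q + r < s - p)]) /= ?addn0 ?addnA //.
move=> p q r s p0 q0 r0 s0 /=; have -> : clsA p r q s = clsA p q r s.
  by rewrite /clsA [odz r && _]andbC.
case: (boolP (clsA p q r s)) => //= /and3P[ps qo ro].
rewrite [r + q]addrC; case: (ltgtP p s) => ps'; case: (ltgtP (s - p) (2 * q));
  case: (ltgtP (s - p) (2 * r)); case: (ltgtP (s - p) (q + r)) => //=; lia.
Qed.

(** The same shift, where [q < s] only ensures that the new [s] is positive. *)
Lemma nquads_C_lt n :
  nquads n (fun p q r s => clsC p q r s && (q < s)) =
  nquads n (fun p q r s => clsA p q r s && (p < r)).
Proof.
rewrite /clsA /clsC.
quad_bij (fun p q r s : int => (p, q, r + p, s - q))
         (fun p q r s : int => (p, q, r - p, s + q)).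
Qed.

Lemma nquads_C_eq n :
  nquads n (fun p q r s => clsC p q r s && (q == s)) =
  nquads n (fun p q r s => clsO p q r s && (p == q)).
Proof.
rewrite /clsO /clsC.
quad_bij (fun p q r s : int => (q, q, p, r)) (fun p q r s : int => (r, p, s, p)).
Qed.

(** After a first substitution the solutions satisfy [q + r < p]. Those with [r] odd lie in [clsO];
    those with [r] even are carried to the part [r < p < q + r] of [clsO]. Parity excludes
    [p = q + r]. *)
Lemma nquads_C_between n :
  nquads n (fun p q r s => [&& clsC p q r s, s < q & q < p + s]) =
  nquads n (fun p q r s => clsO p q r s && (r < p)).
Proof.
have -> : nquads n (fun p q r s => [&& clsC p q r s, s < q & q < p + s]) =
    nquads n (fun p q r s => [&& odz p, odz (s + r), ~~ odz (q + r) & q + r < p]).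
  rewrite /clsC.
  quad_bij (fun p q r s : int => (p + r, q - s, r, s))
           (fun p q r s : int => (p - r, q + s, r, s)).
rewrite (nquads_sum [::
  fun p q r s => clsO p q r s && (q + r < p);
  fun p q r s => [&& odz p, odz s, ~~ odz q, ~~ odz r & q + r < p]]) /=; last first.
  move=> p q r s _ _ _ _; rewrite /clsO /=; case: (q + r < p); rewrite ?andbF //.
  by case: (boolP (odz p)); case: (boolP (odz q)); case: (boolP (odz r));
     case: (boolP (odz s)) => //=; lia.
rewrite [RHS](nquads_sum [::
  fun p q r s => clsO p q r s && (q + r < p);
  fun p q r s => [&& clsO p q r s, r < p & p < q + r]]) /=; last first.
  move=> p q r s _ q0 _ _; case: (boolP (clsO p q r s)) => //= /and4P[po qo ro _].
  by case: (ltgtP p (q + r)); case: (ltP r p) => //=; lia.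
congr (_ + (_ + _))%N; rewrite /clsO.
quad_bij (fun p q r s : int => (r + s, p - q, s, q))
         (fun p q r s : int => (q + s, s, p - r, r)).
Qed.

(** The images here and in the next lemma together make up the part [s < q] of [clsO], since [r = s]
    is excluded by parity. *)
Lemma nquads_O_even_large n :
  nquads n (fun p q r s => clsO p q r s && (p + q + r < s)) =
  nquads n (fun p q r s => [&& clsO p q r s, r < s & s < q]).
Proof.
rewrite /clsO.
quad_bij (fun p q r s : int => (q, s - q, p, r + p))
         (fun p q r s : int => (r, p, s - r, q + p)).
Qed.

Lemma nquads_O_odd_large n :
  nquads n (fun p q r s => clsO p q r s && (q + r + s < p)) =
  nquads n (fun p q r s => [&& clsO p q r s, s < q & s < r]).
Proof.
rewrite /clsO.
quad_bij (fun p q r s : int => (p - q - r - s, q + s, r + s, s))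
         (fun p q r s : int => (p + (q - s) + (r - s) + s, q - s, r - s, s)).
Qed.

(** Split [clsA] with [p < s] by comparing [p] and [r]; equality forces [clsO] and gives the
    right-hand side. By [nquads_C_triangle] and [nquads_A_root] it remains that the count of [clsC]
    with [q < p + s] is that of [clsA] with [p < s] plus that of [clsA] with [q + r < s - p]. Both
    sides equal the count of [clsO] plus that of its part [s < q]. *)
Lemma nquads_AC n :
  (nquads n (fun p q r s =>
     [&& clsA p q r s, p < s, s - p < 2 * q & s - p < 2 * r]%R) +
   nquads n (fun p q r s => [&& clsC p q r s, q < p + s, p < q + s & s < p + q]%R))%N =
  (2 * nquads n (fun p q r s => [&& clsO p q r s, r == p & p < s]%R))%N.
Proof.
have := nquads_C_triangle n; have := nquads_A_root n.
have := nquads_C_lt n; have := nquads_C_eq n; have := nquads_C_between n.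
have := nquads_O_even_large n; have := nquads_O_odd_large n.
have: nquads n (fun p q r s => clsC p q r s && (q < p + s)) =
    (nquads n (fun p q r s => clsC p q r s && (q < s)%R) +
     (nquads n (fun p q r s => clsC p q r s && (q == s)) +
      nquads n (fun p q r s => [&& clsC p q r s, s < q & q < p + s]%R)))%N.
  rewrite (nquads_sum [:: fun p q r s => clsC p q r s && (q < s);
    fun p q r s => clsC p q r s && (q == s);
    fun p q r s => [&& clsC p q r s, s < q & q < p + s]]) /= ?addn0 //.
  move=> p q r s p0 _ _ _; case: (boolP (clsC p q r s)) => //= _.
  by case: (ltgtP q s); case: (ltP q (p + s)) => //=; lia.
have /= := nquads_swap_ps n (fun p q r s => clsO p q r s && (p < r)).
have /= := nquads_swap_qr n (fun p q r s => clsO p q r s && (r < p)).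
have /= := nquads_swap_qr n (fun p q r s => clsO p q r s && (p < r)).
have /= := nquads_swap_qr n (fun p q r s => clsO p q r s && (s < r)).
have /= := nquads_swap_ps n (fun p q r s => clsO p q r s && (s < r)).
have /= := nquads_swap_ps n (fun p q r s => clsO p q r s && (s < p)).
have /= := nquads_swap_ps n (fun p q r s => clsO p q r s && (q + r + s < p)).
have: nquads n (fun p q r s => clsA p q r s && (p < s)) =
    (nquads n (fun p q r s => clsO p q r s && (p < s)%R) +
     nquads n (fun p q r s => clsO s q r p && (p < s)%R))%N.
  rewrite (nquads_sum [:: fun p q r s => clsO p q r s && (p < s);
    fun p q r s => clsO s q r p && (p < s)]) /= ?addn0 //.
  move=> p q r s _ _ _ _; rewrite /clsO /clsA /=; case: (p < s); rewrite ?andbF //.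
  by case: (boolP (odz p)); case: (boolP (odz q)); case: (boolP (odz r));
     case: (boolP (odz s)) => //=; lia.
have: nquads n (fun p q r s => clsA p q r s && (p < s)) =
    (nquads n (fun p q r s => [&& clsA p q r s, p < s & p < r]%R) +
     (nquads n (fun p q r s => [&& clsA p q r s, p < s & r < p]%R) +
      nquads n (fun p q r s => [&& clsO p q r s, r == p & p < s]%R)))%N.
  rewrite (nquads_sum [:: fun p q r s => [&& clsA p q r s, p < s & p < r];
    fun p q r s => [&& clsA p q r s, p < s & r < p];
    fun p q r s => [&& clsO p q r s, r == p & p < s]]) /= ?addn0 //.
  move=> p q r s _ _ _ _; case: (ltP p s); rewrite ?andbF //= !andbT => ps.
  case: (ltgtP p r) => [pr|rp|->]; rewrite ?andbF ?andbT ?addn0 //=.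
  rewrite /clsO /clsA /=.
  by case: (boolP (odz r)); case: (boolP (odz q)); case: (boolP (odz s)) => //=; lia.
have: nquads n clsO =
    (nquads n (fun p q r s => clsO p q r s && (p < s)%R) +
     nquads n (fun p q r s => clsO p q r s && (s < p)%R))%N.
  rewrite (nquads_sum [:: fun p q r s => clsO p q r s && (p < s);
    fun p q r s => clsO p q r s && (s < p)]) /= ?addn0 //.
  move=> p q r s _ _ _ _; case: (boolP (clsO p q r s)) => //= /and4P[po qo ro so].
  by case: (ltgtP p s) => //=; lia.
have: nquads n clsO =
    (nquads n (fun p q r s => clsO p q r s && (q < p)%R) +
     (nquads n (fun p q r s => clsO p q r s && (p == q)) +
      nquads n (fun p q r s => clsO p q r s && (p < q)%R)))%N.
  rewrite (nquads_sum [:: fun p q r s => clsO p q r s && (q < p);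
    fun p q r s => clsO p q r s && (p == q);
    fun p q r s => clsO p q r s && (p < q)]) /= ?addn0 //.
  move=> p q r s _ _ _ _; case: (boolP (clsO p q r s)) => //= /and4P[po qo ro so].
  by case: (ltgtP p q) => //=; lia.
have: nquads n (fun p q r s => clsA p q r s && (p < r)) =
    (nquads n (fun p q r s => clsO p q r s && (p < r)%R) +
     nquads n (fun p q r s => clsO s q r p && (p < r)%R))%N.
  rewrite (nquads_sum [:: fun p q r s => clsO p q r s && (p < r);
    fun p q r s => clsO s q r p && (p < r)]) /= ?addn0 //.
  move=> p q r s _ _ _ _; rewrite /clsO /clsA /=; case: (p < r); rewrite ?andbF //.
  by case: (boolP (odz p)); case: (boolP (odz q)); case: (boolP (odz r));
     case: (boolP (odz s)) => //=; lia.
have: nquads n (fun p q r s => clsA p q r s && (q + r < s - p)) =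
    (nquads n (fun p q r s => clsO p q r s && (p + q + r < s)%R) +
     nquads n (fun p q r s => clsO s q r p && (q + r + p < s)%R))%N.
  rewrite (nquads_sum [:: fun p q r s => clsO p q r s && (p + q + r < s);
    fun p q r s => clsO s q r p && (q + r + p < s)]) /= ?addn0 //.
  move=> p q r s _ _ _ _ /=.
  have -> : (q + r < s - p) = (p + q + r < s) by lia.
  have -> : (q + r + p < s) = (p + q + r < s) by lia.
  rewrite /clsO /clsA /=; case: (p + q + r < s); rewrite ?andbF //.
  by case: (boolP (odz p)); case: (boolP (odz q)); case: (boolP (odz r));
     case: (boolP (odz s)) => //=; lia.
have: nquads n (fun p q r s => clsO p q r s && (s < q)) =
    (nquads n (fun p q r s => [&& clsO p q r s, r < s & s < q]%R) +
     nquads n (fun p q r s => [&& clsO p q r s, s < q & s < r]%R))%N.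
  rewrite (nquads_sum [:: fun p q r s => [&& clsO p q r s, r < s & s < q];
    fun p q r s => [&& clsO p q r s, s < q & s < r]]) /= ?addn0 //.
  move=> p q r s _ _ _ _; case: (boolP (clsO p q r s)) => //= /and4P[po qo ro so].
  by case: (ltP s q); case: (ltgtP r s) => //=; lia.
have eqO (P Q : qpred) :
    (forall p q r s, P p q r s = Q p q r s) -> nquads n P = nquads n Q.
  by move=> PQ; apply: eq_count => -[[[p q] r] s]; apply: PQ.
rewrite (eqO (fun p q r s => clsO p r q s && (q < p))
             (fun p q r s => clsO p q r s && (q < p))); last first.
  by move=> p q r s; rewrite /clsO; lia.
rewrite (eqO (fun p q r s => clsO p r q s && (p < q))
             (fun p q r s => clsO p q r s && (p < q))); last first.
  by move=> p q r s; rewrite /clsO; lia.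
rewrite (eqO (fun p q r s => clsO p r q s && (s < q))
             (fun p q r s => clsO p q r s && (s < q))); last first.
  by move=> p q r s; rewrite /clsO; lia.
lia.
Qed.

(** * A class number relation *)

(** With [J = 2 i + 1], these are the reduced forms [4 a b - J^2 = 4 m - 1]. *)
Definition reduced_forms (m : nat) : seq (int * int * int) :=
  [seq w <- pairs (pairs (ints 1 m) (ints 1 m)) (ints 0 m) |
     let: (a, b, i) := w in
     [&& odz a, odz b, i < a, i < b & a * b == m%:Z + i * (i + 1)]].

Lemma mem_reduced_forms m a b i :
  ((a, b, i) \in reduced_forms m) =
  [&& 0 <= i, odz a, odz b, i < a, i < b & a * b == m%:Z + i * (i + 1)].
Proof.
rewrite mem_filter !mem_pairs !mem_ints.
apply/idP/idP; nia.
Qed.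

Lemma uniq_reduced_forms m : uniq (reduced_forms m).
Proof. by rewrite filter_uniq // !uniq_pairs // uniq_ints. Qed.

(** Pairs of a reduced form and an odd [t = 2 j + 1] with
    [4 a b - J^2 + t^2 = 4 n]. *)
Definition omega (n : nat) : seq quad :=
  [seq w <- pairs (pairs (pairs (ints 1 n) (ints 1 n)) (ints 0 n)) (ints 0 n) |
     let: (a, b, i, j) := w in
     [&& odz a, odz b, i < a, i < b
       & a * b + j * (j + 1) == n%:Z + i * (i + 1)]].

Lemma mem_omega n a b i j :
  ((a, b, i, j) \in omega n) =
  [&& 0 <= i, 0 <= j, odz a, odz b, i < a, i < b
    & a * b + j * (j + 1) == n%:Z + i * (i + 1)].
Proof.
rewrite mem_filter !mem_pairs !mem_ints.
apply/idP/idP; first by lia.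
case/and5P=> i0 j0 oa ob /and3P[ia ib e].
(* These bounds give [a b - i (i + 1) >= max(a, b)], which confines [a], [b] and [j] to the search
   box. *)
have ib' : i * (i + 1) <= (b - 1) * a by apply: ler_pM; lia.
have ia' : i * (i + 1) <= (a - 1) * b by apply: ler_pM; lia.
have j' : j * 1 <= j * (j + 1) by apply: ler_wpM2l; lia.
lia.
Qed.

Lemma uniq_omega m : uniq (omega m).
Proof. by rewrite filter_uniq // !uniq_pairs // uniq_ints. Qed.

Definition odd_pairs (n : nat) : seq (int * int) :=
  [seq w <- pairs (ints 1 n) (ints 1 n) |
     let: (a, b) := w in [&& odz a, odz b & a * b == n%:Z]].

Lemma mem_odd_pairs n a b :
  ((a, b) \in odd_pairs n) =
  [&& 0 < a, 0 < b, odz a, odz b & a * b == n%:Z].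
Proof. by rewrite mem_filter mem_pairs !mem_ints; apply/idP/idP; nia. Qed.

Lemma uniq_odd_pairs n : uniq (odd_pairs n).
Proof. by rewrite filter_uniq // uniq_pairs // uniq_ints. Qed.

(** For odd [n] this realizes the sum of the divisors of [n] as a cardinality, within reach of
    bijections. *)
Definition sigma_triples (n : nat) : seq (int * int * int) :=
  [seq (w, k) | w <- odd_pairs n, k <- ints 1 `|w.1|].

Lemma mem_sigma_triples n a b k :
  ((a, b, k) \in sigma_triples n) =
  [&& 0 < a, 0 < b, 0 < k, odz a, odz b, a * b == n%:Z & k <= a].
Proof.
apply/allpairsPdep/idP => [[[c d] [l]]|abk].
  by rewrite mem_odd_pairs mem_ints /= => -[cd ? [-> -> ->]]; lia.
by exists (a, b), k; rewrite mem_odd_pairs mem_ints /=; split => //; lia.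
Qed.

Lemma uniq_sigma_triples n : uniq (sigma_triples n).
Proof.
apply: allpairs_uniq_dep => [|w _|[w k] [w' k'] _ _ /= [-> ->]] //.
  exact: uniq_odd_pairs.
exact: uniq_ints.
Qed.

Lemma size_sigma_triples n :
  (size (sigma_triples n))%:Z = \sum_(w <- odd_pairs n) w.1.
Proof.
rewrite size_allpairs_dep sumnE big_map -natz natr_sum; apply: eq_big_seq.
by case=> a b; rewrite mem_odd_pairs size_map size_iota natz /=; lia.
Qed.

(** Writing [u = j - i] and [v = i + j + 1], the equation is [a b + u v = n]:
    for [u > 0] it is of the shape [p s + q r = n] already, and for [u < 0] after
    an unimodular change of variables. *)
Lemma omega_lt n :
  count (fun w : quad => let: (a, b, i, j) := w in i < j) (omega n) =
  nquads n (fun p q r s =>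
     [&& clsA p q r s, p < s, s - p < 2 * q & s - p < 2 * r]).
Proof.
rewrite /nquads /clsA.
apply: (count_bij
  (f := fun w : quad => let: (a, b, i, j) := w in (j - i, a, b, i + j + 1))
  (g := fun w : quad => let: (p, q, r, s) := w in
     (q, r, ((s - p) %/ 2)%Z, ((s + p) %/ 2)%Z))).
- exact: uniq_omega.
- exact: uniq_quads.
- move=> [[[a b] i] j]; rewrite /= mem_omega mem_quads => val ij.
  split; [lia | lia | by do ?congr (_, _); lia].
- move=> [[[p q] r] s]; rewrite /= mem_omega mem_quads => val ij.
  have [i sE] : exists i, s = p + 2 * i + 1 by exists ((s - p) %/ 2)%Z; lia.
  rewrite sE in val ij *.
  have -> : ((p + 2 * i + 1 - p) %/ 2)%Z = i by lia.
  have -> : ((p + 2 * i + 1 + p) %/ 2)%Z = i + p by lia.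
  split; [lia | lia | by do ?congr (_, _); lia].
Qed.

(** Here [p + s - q = 2 j + 1], [q + s - p = 2 (a - i) - 1] and [p + q - s = 2 (b - i) - 1]: the
    triangle inequalities encode [0 <= j], [i < a] and [i < b]. *)
Lemma omega_gt n :
  count (fun w : quad => let: (a, b, i, j) := w in j < i) (omega n) =
  nquads n (fun p q r s =>
     [&& clsC p q r s, q < p + s, p < q + s & s < p + q]).
Proof.
rewrite /nquads /clsC.
apply: (count_bij
  (f := fun w : quad => let: (a, b, i, j) := w in
     (b + j - i, a + b - 2 * i - 1, i - j, a + j - i))
  (g := fun w : quad => let: (p, q, r, s) := w in
     (s + r, p + r, ((p + s - q) %/ 2)%Z + r, ((p + s - q) %/ 2)%Z))).
- exact: uniq_omega.
- exact: uniq_quads.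
- move=> [[[a b] i] j]; rewrite /= mem_omega mem_quads => val ij.
  split; [lia | lia | by do ?congr (_, _); lia].
- move=> [[[p q] r] s]; rewrite /= mem_omega mem_quads => val ij.
  (* This witness is the [j] of the [omega] side; substituting it removes the division. *)
  have [i qE] : exists i, q = p + s - 2 * i - 1.
    by exists ((p + s - q) %/ 2)%Z; lia.
  rewrite qE in val ij *.
  have -> : ((p + s - (p + s - 2 * i - 1)) %/ 2)%Z = i by lia.
  split; [lia | lia | by do ?congr (_, _); lia].
Qed.

Lemma omega_eq n :
  count (fun w : quad => let: (a, b, i, j) := w in i == j) (omega n) =
  count (fun w : int * int * int => let: (a, b, k) := w in k <= b)
        (sigma_triples n).
Proof.
apply: (count_bij
  (f := fun w : quad => let: (a, b, i, j) := w in (a, b, i + 1))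
  (g := fun w : int * int * int => let: (a, b, k) := w in
     (a, b, k - 1, k - 1))).
- exact: uniq_omega.
- exact: uniq_sigma_triples.
- move=> [[[a b] i] j]; rewrite /= mem_omega mem_sigma_triples => val ij.
  split; [lia | lia | by do ?congr (_, _); lia].
- move=> [[a b] k]; rewrite /= mem_omega mem_sigma_triples => val ij.
  split; [lia | lia | by do ?congr (_, _); lia].
Qed.

(** As [a] is odd, an even [k <= a] is smaller than [a], and [a b = b k + (a - k) b]. *)
Lemma sigma_gt_even n :
  count (fun w : int * int * int => let: (a, b, k) := w in
    (b < k) && ~~ odz k) (sigma_triples n) =
  nquads n (fun p q r s => [&& clsO p q r s, r == p & p < s]).
Proof.
rewrite /nquads /clsO.
apply: (count_bij
  (f := fun w : int * int * int => let: (a, b, k) := w in (b, a - k, b, k))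
  (g := fun w : quad => let: (p, q, r, s) := w in (s + q, p, s))).
- exact: uniq_sigma_triples.
- exact: uniq_quads.
- move=> [[a b] k]; rewrite /= mem_quads mem_sigma_triples => val ij.
  split; [lia | lia | by do ?congr (_, _); lia].
- move=> [[[p q] r] s]; rewrite /= mem_quads mem_sigma_triples => val ij.
  have rE : r = p by lia.
  rewrite {}rE in val ij *.
  split; [lia | lia | by do ?congr (_, _); lia].
Qed.

(** Since [a] and [b] are odd, the range [b < k <= a] splits into pairs of an even number and its
    successor. *)
Lemma sigma_gt_odd n :
  count (fun w : int * int * int => let: (a, b, k) := w in
    (b < k) && odz k) (sigma_triples n) =
  nquads n (fun p q r s => [&& clsO p q r s, r == p & p < s]).
Proof.
rewrite -sigma_gt_even.
apply: (count_bij
  (f := fun w : int * int * int => let: (a, b, k) := w in (a, b, k - 1))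
  (g := fun w : int * int * int => let: (a, b, k) := w in (a, b, k + 1)));
  rewrite ?uniq_sigma_triples //.
- move=> [[a b] k]; rewrite /= !mem_sigma_triples => val ij.
  split; [lia | lia | by do ?congr (_, _); lia].
- move=> [[a b] k]; rewrite /= !mem_sigma_triples => val ij.
  split; [lia | lia | by do ?congr (_, _); lia].
Qed.

(** The diagonal [i = j] accounts for [k <= b]; [nquads_AC] matches the rest with the even and odd
    [k > b]. *)
Theorem size_omega n : size (omega n) = size (sigma_triples n).
Proof.
rewrite (size_count_sum [::
  (fun w : quad => let: (a, b, i, j) := w in i < j);
  (fun w : quad => let: (a, b, i, j) := w in j < i);
  (fun w : quad => let: (a, b, i, j) := w in i == j)]); last first.
  by move=> [[[a b] i] j] _ /=; lia.
rewrite [RHS](size_count_sum [::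
  (fun w : int * int * int => let: (a, b, k) := w in k <= b);
  (fun w : int * int * int => let: (a, b, k) := w in (b < k) && ~~ odz k);
  (fun w : int * int * int => let: (a, b, k) := w in (b < k) && odz k)]);
  last by move=> [[a b] k] _ /=; lia.
rewrite /= omega_lt omega_gt omega_eq sigma_gt_even sigma_gt_odd.
by have := nquads_AC n; lia.
Qed.

(** * The recurrence for sums of divisors *)

Definition windmills (M : nat) : seq (int * int * int) :=
  [seq w <- pairs (pairs (ints (- M%:Z) (2 * M).+1) (ints 1 M)) (ints 1 M) |
     let: (x, y, z) := w in
     [&& odz x, odz y, odz z & x * x + 4 * y * z == M%:Z]].

Lemma mem_windmills M x y z :
  ((x, y, z) \in windmills M) =
  [&& 0 < y, 0 < z, odz x, odz y, odz z & x * x + 4 * y * z == M%:Z].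
Proof.
rewrite mem_filter !mem_pairs !mem_ints; apply/idP/idP; first by lia.
case/and5P=> y0 z0 ox oy /andP[oz e].
have ? : `|x| * 1 <= `|x| * `|x| by apply: ler_wpM2l; lia.
have ? : y * 1 <= y * z by apply: ler_wpM2l; lia.
have ? : z * 1 <= z * y by apply: ler_wpM2l; lia.
have ? : `|x| * `|x| = x * x by lia.
lia.
Qed.

Lemma uniq_windmills M : uniq (windmills M).
Proof. by rewrite filter_uniq // !uniq_pairs // uniq_ints. Qed.

Lemma windmill_bij M (P Q : pred (int * int * int))
    (f g : int * int * int -> int * int * int) (F : int * int * int -> int) :
    (forall w, w \in windmills M -> P w ->
       [/\ f w \in windmills M, Q (f w) & g (f w) = w]) ->
    (forall w, w \in windmills M -> Q w ->
       [/\ g w \in windmills M, P (g w) & f (g w) = w]) ->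
  \sum_(w <- windmills M | P w) F (f w) = \sum_(w <- windmills M | Q w) F w.
Proof. by move=> fP gP; apply: sum_bij fP gP; apply: uniq_windmills. Qed.

(** The summand is negated by the involution [sg] of the solutions with
    [y < x + z], and [rho] exchanges these with the remaining ones ([y = x + z]
    is excluded by parity). *)
Lemma windmill_sum M :
  \sum_(w <- windmills M)
     (let: (x, y, z) := w in (x - y) * (x + z) * (y + z)) = 0.
Proof.
set G := fun w : int * int * int =>
  let: (x, y, z) := w in (x - y) * (x + z) * (y + z).
pose U w := let: (x, y, z) := w : int * int * int in y < x + z.
pose rho w := let: (x, y, z) := w : int * int * int in (- x, z, y).
pose sg w := let: (x, y, z) := w : int * int * int in (2 * y - x, y, z + x - y).
have sumU : \sum_(w <- windmills M | U w) G w = 0.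
  suff: \sum_(w <- windmills M | U w) G w = - \sum_(w <- windmills M | U w) G w.
    lia.
  rewrite -[in LHS](@windmill_bij M U U sg sg) -?sumrN.
  - by apply: eq_bigr => -[[x y] z] _ /=; lia.
  - move=> [[x y] z]; rewrite /= !mem_windmills => w0 Uw.
    by split; [lia | lia | do ?congr (_, _); lia].
  - move=> [[x y] z]; rewrite /= !mem_windmills => w0 Uw.
    by split; [lia | lia | do ?congr (_, _); lia].
rewrite (bigID U) /= [X in X + _]sumU add0r -[RHS]sumU.
rewrite -[RHS](@windmill_bij M (fun w => ~~ U w) U rho rho).
- by apply: eq_bigr => -[[x y] z] _ /=; lia.
- move=> [[x y] z]; rewrite /= !mem_windmills => w0 Uw.
  by split; [lia | lia | do ?congr (_, _); lia].
- move=> [[x y] z]; rewrite /= !mem_windmills => w0 Uw.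
  by split; [lia | lia | do ?congr (_, _); lia].
Qed.

Definition tri (j : nat) : nat := (j * j.+1)./2.

Lemma tri2 j : (2 * tri j = j * j.+1)%N.
Proof. by rewrite -[RHS]odd_double_half oddM /= andbN add0n mul2n. Qed.

Lemma leq_tri j : (j <= tri j)%N.
Proof. by have := tri2 j; nia. Qed.

(** The terms of [windmill_sum] at [x] and [-x] add up to [-2 (y z - x^2) (y + z)], and by symmetry
    [y] and [z] contribute equally. *)
Lemma windmill_sum_pos M :
  \sum_(w <- windmills M | 0 < w.1.1)
     (let: (x, y, z) := w in (y * z - x * x) * y) = 0.
Proof.
set H := fun w : int * int * int =>
  let: (x, y, z) := w in (y * z - x * x) * y.
have := windmill_sum M.
set G := fun w : int * int * int =>
  let: (x, y, z) := w in (x - y) * (x + z) * (y + z).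
pose neg w := let: (x, y, z) := w : int * int * int in (- x, y, z).
pose swp w := let: (x, y, z) := w : int * int * int in (x, z, y).
rewrite (bigID (fun w => 0 < w.1.1)) /=.
rewrite -[X in _ + X](@windmill_bij M (fun w => 0 < w.1.1) _ neg neg); last 2 first.
- move=> [[x y] z]; rewrite /= !mem_windmills => w0 Uw.
  by split; [lia | lia | do ?congr (_, _); lia].
- move=> [[x y] z]; rewrite /= !mem_windmills => w0 Uw.
  by split; [lia | lia | do ?congr (_, _); lia].
rewrite -big_split /=.
have : \sum_(w <- windmills M | 0 < w.1.1) H w =
       \sum_(w <- windmills M | 0 < w.1.1) H (swp w).
  symmetry; apply: (@windmill_bij M _ _ swp swp).
  - move=> [[x y] z]; rewrite /= !mem_windmills => w0 Uw.
    by split; [lia | lia | do ?congr (_, _); lia].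
  - move=> [[x y] z]; rewrite /= !mem_windmills => w0 Uw.
    by split; [lia | lia | do ?congr (_, _); lia].
rewrite [X in _ -> X = 0 -> _](eq_bigr (fun w => - 2 * (H w + H (swp w)))); last first.
  by move=> [[x y] z] _; rewrite /G /H /=; ring.
rewrite -mulr_sumr big_split /= => <-.
by move: (\sum_(w <- _ | _) H w) => s; lia.
Qed.

(** For [x = 2 j + 1] one has [x^2 = 8 tri j + 1], so [y z = 2 (N - tri j) + 1] and
    [y z - x^2 = 2 (N - 5 tri j)]. *)
Lemma windmill_fiber N j :
  \sum_(w <- windmills (8 * N + 5) | (0 < w.1.1) && (`|w.1.1|./2 == j)%N)
     (let: (x, y, z) := w in (y * z - x * x) * y) =
  if (N < tri j)%N then 0
  else 2 * (N%:Z - 5 * (tri j)%:Z) * (size (sigma_triples (2 * (N - tri j)).+1))%:Z.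
Proof.
have jj := tri2 j; case: ltnP => [Nj|jN].
  rewrite big_seq_cond big_pred0 // => -[[x y] z].
  rewrite mem_windmills /=; apply/negP => w.
  have xE : x = 2 * j%:Z + 1 by lia.
  have yz : 0 < y * z by apply: mulr_gt0; lia.
  by rewrite xE in w; lia.
rewrite size_sigma_triples mulr_sumr.
rewrite -(@sum_bij _ _ _ (odd_pairs (2 * (N - tri j)).+1) _ xpredT _
  (fun w => (2 * j%:Z + 1, w.1, w.2)) (fun w => (w.1.2, w.2))).
- apply: eq_big_seq => -[y z]; rewrite mem_odd_pairs /= => /and5P[_ _ _ _ /eqP ->].
  by congr (_ * _); lia.
- exact: uniq_odd_pairs.
- exact: uniq_windmills.
- by move=> [y z]; rewrite mem_odd_pairs mem_windmills /= => w _; split => //; lia.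
- move=> [[x y] z]; rewrite mem_odd_pairs mem_windmills /= => w wj.
  have xE : x = 2 * j%:Z + 1 by lia.
  by rewrite xE in w *; split => //; lia.
Qed.

Lemma sigma_recurrence N K : (N < K)%N ->
  \sum_(j < K) (if (N < tri j)%N then 0 else
    (N%:Z - 5 * (tri j)%:Z) * (size (sigma_triples (2 * (N - tri j)).+1))%:Z) = 0.
Proof.
move=> NK; apply: (@mulfI _ 2) => //; rewrite mulr0 mulr_sumr.
rewrite -[RHS](windmill_sum_pos (8 * N + 5)).
rewrite (@sum_fibers _ _ _ _ K (fun w => `|w.1.1|./2)%N); last first.
  case=> -[x y] z; rewrite mem_windmills /= => w x0.
  have [j xE] : exists j, `|x|%N = (2 * j).+1 by exists (`|x|./2)%N; lia.
  have tj := tri2 j; have := leq_tri j.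
  have yz : 0 < y * z by apply: mulr_gt0; lia.
  have xE' : x = 2 * j%:Z + 1 by lia.
  by rewrite xE' in w *; lia.
apply: eq_bigr => j _; rewrite windmill_fiber.
by case: ifP => _; rewrite ?mulr0 // mulrA.
Qed.

Lemma omega_fiber N j :
  count (fun w : quad => `|w.2|%N == j) (omega (2 * N).+1) =
  if (N < tri j)%N then 0%N else size (reduced_forms (2 * (N - tri j)).+1).
Proof.
have jj := tri2 j; case: ltnP => [Nj|jN].
  apply/eqP; rewrite -leqn0 leqNgt -has_count; apply/hasPn => -[[[a b] i] j'].
  rewrite mem_omega /= => w; apply/negP => /eqP jE.
  have jE' : j' = j%:Z by lia.
  have ab : i * (i + 1) <= (b - 1) * a by apply: ler_pM; lia.
  by rewrite jE' in w; lia.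
rewrite -count_predT.
apply: (count_bij (f := fun w : quad => w.1)
                  (g := fun w : int * int * int => (w, j%:Z))).
- exact: uniq_omega.
- exact: uniq_reduced_forms.
- move=> [[[a b] i] j']; rewrite mem_omega mem_reduced_forms /= => w wj.
  have jE : j' = j%:Z by lia.
  by rewrite jE in w *; split => //; lia.
- move=> [[a b] i]; rewrite mem_omega mem_reduced_forms /= => w _.
  by split => //; lia.
Qed.

(** The class number relation sorted by [j]: the series counting reduced forms, times [psi], is the
    divisor-sum series. *)
Lemma forms_recurrence N K : (N < K)%N ->
  (\sum_(j < K) (if N < tri j then 0
     else size (reduced_forms (2 * (N - tri j)).+1)) =
   size (sigma_triples (2 * N).+1))%N.
Proof.
move=> NK; rewrite -size_omega -sum1_size.
rewrite (@sum_fibers _ nat _ xpredT K (fun w => `|w.2|)%N); last first.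
  case=> -[[a b] i] j; rewrite mem_omega /= => w _.
  have ab : i * (i + 1) <= (b - 1) * a by apply: ler_pM; lia.
  have := leq_tri `|j|; have := tri2 `|j|.
  have [k jE] : exists k : nat, j = k%:Z by exists `|j|%N; lia.
  by rewrite jE in w *; rewrite absz_nat; lia.
by apply: eq_bigr => j _; rewrite sum1_count omega_fiber.
Qed.

(** * Three triangular numbers *)

(** A triangular system: the term [j = 0] is [c N 0 * d N], and all others involve earlier values of
    [d]. The first alternative covers indices where [c N 0] vanishes. *)
Lemma tri_conv_inj (K : nat) (c : nat -> nat -> int) (d : nat -> int) :
    (forall N, (N < K)%N -> d N = 0 \/ c N 0%N != 0) ->
    (forall N, (N < K)%N ->
       \sum_(j < K) (if (N < tri j)%N then 0 else c N j * d (N - tri j)%N) = 0) ->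
  forall N, (N < K)%N -> d N = 0.
Proof.
move=> dc conv0; elim/ltn_ind => N IHN NK.
have [//|cN] := dc N NK; have := conv0 N NK.
have K0 : (0 < K)%N by apply: leq_trans NK.
rewrite (bigD1 (Ordinal K0)) //= subn0 big1 ?addr0 => [/eqP|j j0].
  by rewrite mulf_eq0 (negPf cN) => /eqP.
case: ltnP => // jN; rewrite IHN ?mulr0 //; last first.
  exact: leq_ltn_trans (leq_subr _ _) NK.
have : (0 < j)%N by rewrite lt0n; apply: contraNneq j0 => j0; apply/eqP/val_inj.
by have := leq_tri j; lia.
Qed.

(** Truncated to stay a polynomial; as [j <= tri j], coefficients below [K] are those of the full
    series. *)
Definition psi (K : nat) : {poly int} := \sum_(j < K) 'X^(tri j).

Lemma coef_psiM K p N :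
  (psi K * p)`_N = \sum_(j < K) if (N < tri j)%N then 0 else p`_(N - tri j).
Proof.
by rewrite mulr_suml coef_sum; apply: eq_bigr => j _; rewrite coefXnM.
Qed.

Lemma coef_psi'M K p N :
  ('X * (psi K)^`() * p)`_N =
  \sum_(j < K) if (N < tri j)%N then 0 else (tri j)%:Z * p`_(N - tri j).
Proof.
rewrite linear_sum /= mulr_sumr mulr_suml coef_sum; apply: eq_bigr => j _.
rewrite derivXn mulrnAr -(exprS 'X) mulrnAl coefMn.
case: (posnP (tri j)) => [->|tj]; first by rewrite mulr0n ltn0 mul0r.
by rewrite prednK // coefXnM; case: ifP; rewrite ?mul0rn // -mulr_natl natz.
Qed.

Lemma coef_Xderiv (R : nzRingType) (p : {poly R}) N : ('X * p^`())`_N = p`_N *+ N.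
Proof. by rewrite coefXM; case: N => [|N]; rewrite ?mulr0n // coef_deriv. Qed.

(** Coefficients of [psi * (psi^4)' = 4 * psi' * psi^4]. *)
Lemma psi4_recurrence K N :
  \sum_(j < K) (if (N < tri j)%N then 0 else
    (N%:Z - 5 * (tri j)%:Z) * (psi K ^+ 4)`_(N - tri j)) = 0.
Proof.
have : psi K * ('X * (psi K ^+ 4)^`()) =
       4%:R * ('X * (psi K)^`() * psi K ^+ 4) by rewrite !derivE; ring.
move/(congr1 (fun p : {poly int} => p`_N)).
rewrite coef_psiM mulr_natl coefMn coef_psi'M => /eqP.
rewrite -subr_eq0 -sumrMnl -sumrB => /eqP e; rewrite -[RHS]e.
apply: eq_bigr => j _; case: ltnP => [|jN]; first by rewrite mul0rn subr0.
rewrite coef_Xderiv; move: (_`_(N - tri j)) => c.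
by rewrite -(mulr_natr c) -(mulr_natr (_ * c)) !natz -subzn //; ring.
Qed.

Lemma psi_coef0 K : (0 < K)%N -> (psi K)`_0 = 1.
Proof.
move=> K0; rewrite coef_sum (bigD1 (Ordinal K0)) //= coefXn big1 ?addr0 // => j j0.
have : (0 < j)%N by rewrite lt0n; apply: contraNneq j0 => j0; apply/eqP/val_inj.
by rewrite coefXn; have := leq_tri j; case: eqP => //; lia.
Qed.

(** Both sequences satisfy the same recurrence, with leading factor [N]; at [N = 0], where it
    vanishes, both are [1]. *)
Lemma psi4_sigma K N : (N < K)%N ->
  (psi K ^+ 4)`_N = (size (sigma_triples (2 * N).+1))%:Z.
Proof.
move=> NK; apply/eqP; rewrite -subr_eq0; apply/eqP; move: N NK.
apply: (@tri_conv_inj K (fun N j => N%:Z - 5 * (tri j)%:Z)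
  (fun N => (psi K ^+ 4)`_N - (size (sigma_triples (2 * N).+1))%:Z)) => N NK.
  case: N NK => [|N] NK; [left | by right; rewrite mulr0 subr0].
  by rewrite -horner_coef0 horner_exp horner_coef0 psi_coef0 // expr1n.
have := congr2 (fun a b => a - b) (psi4_recurrence K N) (sigma_recurrence NK).
rewrite subr0 -sumrB => e; rewrite -[RHS]e; apply: eq_bigr => j _.
by case: ifP => _; rewrite ?subr0 // mulrBr.
Qed.

(** Multiplied by [psi], both sides give the divisor sums; [psi] has constant term [1] and
    cancels. *)
Lemma psi3_forms K N : (N < K)%N ->
  (psi K ^+ 3)`_N = (size (reduced_forms (2 * N).+1))%:Z.
Proof.
move=> NK; apply/eqP; rewrite -subr_eq0; apply/eqP; move: N NK.
apply: (@tri_conv_inj K (fun N j => 1)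
  (fun N => (psi K ^+ 3)`_N - (size (reduced_forms (2 * N).+1))%:Z)) => N NK.
  by right.
transitivity ((psi K ^+ 4)`_N - (size (sigma_triples (2 * N).+1))%:Z); last first.
  by rewrite psi4_sigma // subrr.
rewrite -(forms_recurrence NK) exprS coef_psiM -natz natr_sum -sumrB.
by apply: eq_bigr => j _; case: ifP => _; rewrite ?subr0 // mul1r natz.
Qed.

Lemma coef_psiM_neq0 K p N : (psi K * p)`_N != 0 ->
  exists j, (tri j <= N)%N /\ p`_(N - tri j) != 0.
Proof.
rewrite coef_psiM => nz.
have /existsP[j /andP[jN pj]] :
    [exists j : 'I_K, (tri j <= N)%N && (p`_(N - tri j) != 0)].
  apply: contraNT nz => /existsPn noj; rewrite big1 // => j _.
  have := noj j; rewrite negb_and negbK; case: ltnP => //= _.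
  by move/eqP.
by exists j.
Qed.

Theorem three_triangular N : exists x y z, N = (tri x + tri y + tri z)%N.
Proof.
have : (psi N.+1 ^+ 3)`_N != 0.
  (* The principal form, with [J = 1], shows that the count is positive. *)
  have : (1, (2 * N).+1%:Z, 0) \in reduced_forms (2 * N).+1.
    by rewrite mem_reduced_forms; lia.
  by rewrite psi3_forms //; case: reduced_forms.
(* The final factor [1] has a nonzero coefficient only at [0], so the three exponents add up to
   exactly [N]. *)
have -> : psi N.+1 ^+ 3 = psi N.+1 * (psi N.+1 * (psi N.+1 * 1)) by ring.
case/coef_psiM_neq0=> x [xN] /coef_psiM_neq0[y [yN]] /coef_psiM_neq0[z [zN]].
rewrite coef1; case: eqP => // zE _; exists x, y, z; lia.
Qed.

(** * Sums of nine rationals *)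

Definition cube_triple (l k : rat) : seq rat :=
  let A := k ^+ 2 - k + 1 in let B := k ^+ 2 + k + 1 in
  [:: l * A ^+ 2 / (2 * B); l * B ^+ 2 / (2 * A); 4 * l / (A * B)].

(** The sum is [l (A^3 + B^3 + 8) / (2 A B)]. With [u = k^2 + 1], [A + B = 2 u] and
    [A B = u^2 - u + 1], so [A^3 + B^3 + 8 = 8 (u^3 + 1) - 6 u A B = 2 A B (u + 4)]. *)
Lemma cube_tripleP l k : 0 < l ->
  [/\ all (fun x => 0 < x) (cube_triple l k),
      \prod_(x <- cube_triple l k) x = l ^+ 3
    & \sum_(x <- cube_triple l k) x = l * (k ^+ 2 + 5)].
Proof.
move=> l0.
have A0 : 0 < k ^+ 2 - k + 1 by nra.
have B0 : 0 < k ^+ 2 + k + 1 by nra.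
have An := lt0r_neq0 A0; have Bn := lt0r_neq0 B0.
split.
- by rewrite /= !divr_gt0 ?mulr_gt0 ?exprn_gt0.
- by rewrite !big_cons big_nil; field; rewrite An Bn.
- by rewrite !big_cons big_nil; field; rewrite An Bn.
Qed.

Definition sum_prod1 (n m : nat) : Prop :=
  exists s : seq rat, [/\ size s = n, all (fun x => 0 < x) s,
    \prod_(x <- s) x = 1 & \sum_(x <- s) x = m%:R].

Lemma sum_prod1_in_A n m : (0 < m)%N -> sum_prod1 n m -> in_A n m.
Proof.
move=> m0 [s [sn s0 s1 sm]]; split=> //; exists (fun i => s`_i).
split; first by move=> i; apply: (all_nthP 0 s0); rewrite sn.
by move: s1 sm; rewrite (big_nth 0) [X in _ -> X = _ -> _](big_nth 0) !big_mkord sn.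
Qed.

Lemma sum_prod1_pad n m d : sum_prod1 n m -> sum_prod1 (d + n) (d + m).
Proof.
move=> [s [sn s0 s1 sm]]; exists (nseq d 1 ++ s); split.
- by rewrite size_cat size_nseq sn.
- by rewrite all_cat s0 andbT all_nseq ltr01 orbT.
- by rewrite big_cat /= s1 mulr1 big1_seq // => x /nseqP[->].
- rewrite big_cat /= sm natrD; congr (_ + _).
  by rewrite big_nseq iter_addr_0.
Qed.

Lemma sum_prod1_large m : (41 <= m)%N -> sum_prod1 9 m.
Proof.
(* Here [8 (2 m - 81) + 3 = 16 m - 645], and [41 <= m] keeps the subtraction from truncating. *)
move=> m41; have [i [j [k ijk]]] := three_triangular (2 * m - 81).
have ti := tri2 i; have tj := tri2 j; have tk := tri2 k.
have E : ((2 * i + 1) ^ 2 + (2 * j + 1) ^ 2 + (2 * k + 1) ^ 2 + 645 = 16 * m)%N.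
  by lia.
pose x : rat := (2 * i + 1)%:R; pose y : rat := (2 * j + 1)%:R.
pose z : rat := (2 * k + 1)%:R.
have E' : x ^+ 2 + y ^+ 2 + z ^+ 2 + 645 = 16 * m%:R.
  by rewrite -!natrX -natrM -E !natrD.
(* The scalings satisfy [4 * 4 / 16 = 1] and give all three squares the coefficient [1/16]; the
   constants total [20 + 20 + 5/16 = 645/16]. *)
have [p1 q1 s1] := @cube_tripleP 4 (x / 8) isT.
have [p2 q2 s2] := @cube_tripleP 4 (y / 8) isT.
have [p3 q3 s3] := @cube_tripleP (1 / 16) z isT.
exists (cube_triple 4 (x / 8) ++ cube_triple 4 (y / 8) ++ cube_triple (1 / 16) z).
split.
- by [].
- by rewrite !all_cat p1 p2 p3.
- by rewrite !big_cat /= q1 q2 q3; field.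
- rewrite !big_cat /= s1 s2 s3.
  have -> : m%:R = (x ^+ 2 + y ^+ 2 + z ^+ 2 + 645) / 16 by rewrite E'; field.
  by field.
Qed.

(** Numerators and denominators are naturals so that size and positivity compute; [d] counts the
    entries equal to [1]. *)
Lemma sum_prod1_fractions n m d (l : seq (nat * nat)) :
    (size l + d = n)%N -> all (fun x => (0 < x.1) && (0 < x.2))%N l ->
    foldr (fun x y => x.1%:R / x.2%:R * y) 1 l = 1 :> rat ->
    foldr (fun x y => x.1%:R / x.2%:R + y) d%:R l = m%:R :> rat ->
  sum_prod1 n m.
Proof.
move=> <- /allP l0 l1 lm; exists ([seq x.1%:R / x.2%:R | x <- l] ++ nseq d 1).
split.
- by rewrite size_cat size_map size_nseq.
- rewrite all_cat all_nseq ltr01 orbT andbT all_map; apply/allP => x /l0 /andP[? ?].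
  by rewrite /= divr_gt0 ?ltr0n.
- rewrite big_cat /= big_map [X in _ * X]big1_seq ?mulr1 => [|x /nseqP[]//].
  rewrite -[RHS]l1; elim: l {l0 l1 lm} => [|x l IHl]; first by rewrite big_nil.
  by rewrite big_cons /= -IHl.
- rewrite big_cat /= big_map big_nseq iter_addr_0 -lm.
  elim: l {l0 l1 lm} => [|x l IHl]; first by rewrite big_nil add0r.
  by rewrite big_cons /= -IHl addrA.
Qed.

Tactic Notation "fractions" uconstr(d) uconstr(l) :=
  by refine (@sum_prod1_fractions _ _ d l _ _ _ _);
     [| | rewrite /foldr /fst /snd; field | rewrite /foldr /fst /snd; field].

(** The lists omit entries equal to [1], and the number of these comes first. *)
Lemma sum_prod1_small m : (9 <= m <= 40)%N -> sum_prod1 9 m.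
Proof.
do 9 case: m => [|m] //.
case: m => [_|m]; first fractions 9 [::].
case: m => [_|m]; first fractions 5 [:: (1, 2); (1, 2); (2, 1); (2, 1)].
case: m => [_|m]; first fractions 6 [:: (1, 2); (1, 2); (4, 1)].
case: m => [_|m]; first fractions 6 [:: (1, 6); (4, 3); (9, 2)].
case: m => [_|m]; first fractions 4 [:: (1, 12); (2, 3); (2, 1); (9, 4); (4, 1)].
case: m => [_|m]; first fractions 5 [:: (1, 6); (1, 3); (4, 1); (9, 2)].
case: m => [_|m]; first fractions 4 [:: (1, 12); (1, 3); (9, 4); (3, 1); (16, 3)].
case: m => [_|m]; first fractions 5 [:: (1, 12); (2, 3); (9, 4); (8, 1)].
case: m => [_|m]; first fractions 4 [:: (1, 6); (1, 3); (1, 2); (6, 1); (6, 1)].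
case: m => [_|m]; first fractions 5 [:: (1, 12); (3, 4); (3, 2); (32, 3)].
case: m => [_|m]; first fractions 5 [:: (1, 6); (1, 3); (3, 2); (12, 1)].
case: m => [_|m]; first fractions 5 [:: (1, 6); (2, 3); (2, 3); (27, 2)].
case: m => [_|m];
  first fractions 3 [:: (1, 12); (1, 4); (1, 4); (16, 3); (16, 3); (27, 4)].
case: m => [_|m]; first fractions 4 [:: (1, 12); (1, 4); (2, 3); (8, 1); (9, 1)].
case: m => [_|m]; first fractions 4 [:: (1, 12); (1, 4); (2, 3); (6, 1); (12, 1)].
case: m => [_|m]; first fractions 4 [:: (1, 12); (1, 8); (9, 8); (8, 1); (32, 3)].
case: m => [_|m]; first fractions 4 [:: (1, 12); (1, 12); (2, 1); (16, 3); (27, 2)].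
case: m => [_|m]; first fractions 5 [:: (1, 12); (1, 4); (8, 3); (18, 1)].
case: m => [_|m]; first fractions 4 [:: (1, 12); (1, 12); (4, 3); (8, 1); (27, 2)].
case: m => [_|m]; first fractions 4 [:: (1, 6); (1, 4); (1, 4); (16, 3); (18, 1)].
case: m => [_|m]; first fractions 4 [:: (1, 12); (1, 12); (3, 2); (16, 3); (18, 1)].
case: m => [_|m]; first fractions 4 [:: (1, 4); (1, 3); (2, 3); (3, 4); (24, 1)].
case: m => [_|m];
  first fractions 3 [:: (1, 6); (1, 6); (1, 6); (3, 2); (8, 1); (18, 1)].
case: m => [_|m]; first fractions 4 [:: (1, 12); (1, 4); (2, 3); (3, 1); (24, 1)].
case: m => [_|m]; first fractions 5 [:: (1, 3); (1, 3); (1, 3); (27, 1)].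
case: m => [_|m]; first fractions 4 [:: (1, 12); (1, 12); (4, 3); (9, 2); (24, 1)].
case: m => [_|m];
  first fractions 3 [:: (1, 12); (1, 12); (1, 3); (2, 1); (27, 2); (16, 1)].
case: m => [_|m]; first fractions 4 [:: (1, 9); (1, 6); (2, 9); (27, 2); (18, 1)].
case: m => [_|m]; first fractions 4 [:: (1, 12); (1, 4); (1, 3); (16, 3); (27, 1)].
case: m => [_|m]; first fractions 5 [:: (1, 4); (1, 4); (1, 2); (32, 1)].
case: m => [_|m]; first fractions 4 [:: (1, 6); (1, 4); (1, 3); (9, 4); (32, 1)].
case: m => [_|m]; first fractions 4 [:: (1, 12); (1, 8); (9, 8); (8, 3); (32, 1)].
by [].
Qed.

Lemma sum_prod1_exists n m : (9 <= n)%N -> (n <= m)%N -> sum_prod1 n m.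
Proof.
move=> n9 nm; have -> : n = (n - 9 + 9)%N by rewrite subnK.
have -> : m = (n - 9 + (m - (n - 9)))%N by lia.
apply: sum_prod1_pad; case: (leqP 41 (m - (n - 9))) => [|m40].
  exact: sum_prod1_large.
by apply: sum_prod1_small; lia.
Qed.

Lemma in_A_ge n k : (0 < n)%N -> in_A n k -> (n <= k)%N.
Proof.
move=> n0 [k0 [a [a0 [a1 ak]]]].
have [] := @leif_AGM rat 'I_n predT a (fun i _ => ltW (a0 i)).
rewrite cardT size_enum_ord a1 ak => le1 _.
have {le1} : 1 <= (k%:R / n%:R : rat).
  (* AM-GM bounds the [n]-th power of the mean below by [1]; the mean is nonnegative, so it is
     itself at least [1]. *)
  by rewrite -(@expr_ge1 _ n) // divr_ge0 ?ler0n.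
by rewrite ler_pdivlMr ?ltr0n // mul1r ler_nat.
Qed.

Theorem theorem2p2 (n : nat) : (9 <= n)%N ->
  forall k : nat, in_A n k <-> (0 < k)%N /\ (n <= k)%N.
Proof.
move=> n9 k; split=> [kA|[k0 nk]].
  by split; [case: kA | apply: in_A_ge kA; apply: leq_trans n9].
exact: sum_prod1_in_A k0 (sum_prod1_exists n9 nk).
Qed.
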